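(* Let $F$ be an algebraically closed field of characteristic different from $2$ and let $\mathbf{O}$ be the octonion algebra over $F$. The module $\Lambda^2(\mathbf{O})$, subject to the twisted action of $SO(7)$ given by $g\cdot v=\rho(g)v$ for $g\in SO(7)$, $v\in\Lambda^2(\mathbf{O})$ (where $\rho$ is the triality automorphism of $PSO(8)$ described in the context), is isomorphic to $\mathbf{O}_0\oplus\Lambda^2(\mathbf{O}_0)$, where $\mathbf{O}_0$ is the natural $SO(7)$-module of traceless octonions.
   Context: $\mathbf{O}$ is the Zorn vector-matrix algebra over $F$, consisting of all $a=\begin{pmatrix}\alpha&\mathbf{u}\\ \mathbf{v}&\beta\end{pmatrix}$ with $\alpha,\beta\in F$, $\mathbf{u},\mathbf{v}\in F^3$, and multiplication $$\begin{pmatrix}\alpha&\mathbf{u}\\ \mathbf{v}&\beta\end{pmatrix}\begin{pmatrix}\alpha'&\mathbf{u}'\\ \mathbf{v}'&\beta'\end{pmatrix}=\begin{pmatrix}\alpha\alpha'+\mathbf{u}\cdot\mathbf{v}'&\alpha\mathbf{u}'+\beta'\mathbf{u}-\mathbf{v}\times\mathbf{v}'\\ \alpha'\mathbf{v}+\beta\mathbf{v}'+\mathbf{u}\times\mathbf{u}'&\beta\beta'+\mathbf{v}\cdot\mathbf{u}'\end{pmatrix}.$$ Norm $n(a)=\alpha\beta-\mathbf{u}\cdot\mathbf{v}$ with associated bilinear form $q$; trace $t(a)=\alpha+\beta$; $\mathbf{O}_0=\{a:t(a)=0\}$, the orthogonal complement of $1_{\mathbf{O}}$; $\mathbf{O}_1=\{a: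 n(a)=1\}$. $SO(8)=SO(\mathbf{O},q)$ is generated by $L_x:z\mapsto xz$ and $R_x:z\mapsto zx$ for $x\in\mathbf{O}_1$; $PSO(8)=SO(8)/\{\pm E\}$. For $x\in M=\mathbf{O}_1/\{\pm1_{\mathbf{O}}\}$ write $L_x,R_x$ also for the induced elements of $PSO(8)$, and put $P_x=L_x^{-1}R_x^{-1}$. The triality automorphism $\rho$ of $PSO(8)$ is the automorphism of order $3$ determined by $R_x^\rho=P_x$, $L_x^\rho=R_x$, $P_x^\rho=L_x$ for all $x\in M$. $SO(7)=\mathrm{Stab}_{SO(8)}(1_{\mathbf{O}})$ is identified with its image in $PSO(8)$. Since $-E$ acts trivially on $\mathbf{O}^{\otimes2}$, $\Lambda^2(\mathbf{O})$ is a $PSO(8)$-module, so $\rho(g)v$ makes sense. *)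

(* Defs.v *)
From HB Require Import structures.
From mathcomp Require Import all_boot all_order all_algebra.
From mathcomp Require Import ring boolp.


Set Implicit Arguments.
Unset Strict Implicit.
Unset Printing Implicit Defensive.

Import GRing.Theory passmx.
Local Open Scope ring_scope.
Local Open Scope quotient_scope.

Section ExteriorSquare.
Variables (F : fieldType) (V : vectType F).

Local Notation b := (vbasis {:V}).
Local Notation n := (\dim {:V}).

(* The tensor square of V is realised as the matrices over the basis b: the
   matrix X stands for the tensor \sum_(i, j) X i j *: (b_i (x) b_j). *)
Definition tens2 (u v : V) : 'M[F]_n := (rVof b u)^T *m rVof b v.

Definition tens2_map (f : 'End(V)) (X : 'M[F]_n) : 'M[F]_n :=
  (mxof b b f)^T *m X *m mxof b b f.

Lemma tens2_mapE f u v : tens2_map f (tens2 u v) = tens2 (f u) (f v).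
Proof.
have bB : basis_of {:V} b := vbasisP _.
rewrite /tens2_map /tens2 !mulmxA -trmx_mul -mulmxA.
by rewrite -!rVof_app.
Qed.

Fact tens2_map_is_linear f : linear (tens2_map f).
Proof.
by move=> a X Y; rewrite /tens2_map mulmxDr mulmxDl -scalemxAr -scalemxAl.
Qed.
HB.instance Definition _ f := GRing.isLinear.Build F 'M[F]_n 'M[F]_n _
  (tens2_map f) (tens2_map_is_linear f).

(* The span of all the squares v (x) v: the lemma sqr_tensP below shows that
   the finitely many squares listed here suffice. *)
Definition sqr_tens : {vspace 'M[F]_n} :=
  span [seq tens2 v v | v <- b ++ [seq x + y | x <- b, y <- b]].

Fact tens2Dl u v w : tens2 (u + v) w = tens2 u w + tens2 v w.
Proof. by rewrite /tens2 [rVof _ (_ + _)]linearD linearD mulmxDl. Qed.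
Fact tens2Dr u v w : tens2 w (u + v) = tens2 w u + tens2 w v.
Proof. by rewrite /tens2 [rVof _ (_ + _)]linearD mulmxDr. Qed.
Fact tens2Zl a u w : tens2 (a *: u) w = a *: tens2 u w.
Proof. by rewrite /tens2 [rVof _ (_ *: _)]linearZ linearZ /= scalemxAl. Qed.
Fact tens2Zr a u w : tens2 w (a *: u) = a *: tens2 w u.
Proof. by rewrite /tens2 [rVof _ (_ *: _)]linearZ /= scalemxAr. Qed.

Lemma sqr_tensP v : tens2 v v \in sqr_tens.
Proof.
have tens2_0l w : tens2 0 w = 0 by rewrite /tens2 linear0 trmx0 mul0mx.
have tens2_0r w : tens2 w 0 = 0 by rewrite /tens2 linear0 mulmx0.
have bsq x : x \in (b : seq V) -> tens2 x x \in sqr_tens.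
  by move=> xb; apply: memv_span; apply: map_f; rewrite mem_cat xb.
have bsym x y : x \in (b : seq V) -> y \in (b : seq V) ->
    tens2 x y + tens2 y x \in sqr_tens.
  move=> xb yb.
  have -> : tens2 x y + tens2 y x =
      tens2 (x + y) (x + y) - tens2 x x - tens2 y y.
    rewrite tens2Dl !tens2Dr addrA (addrAC _ _ (- tens2 y y)) addrK -addrA.
    by rewrite [tens2 x x + _]addrC addrACA subrr addr0.
  apply: rpredB; last exact: bsq.
  apply: rpredB; last exact: bsq.
  apply: memv_span; apply: map_f; rewrite mem_cat; apply/orP; right.
  exact: allpairs_f.
rewrite (coord_vbasis (memvf v)).
pose P (u : V) := tens2 u u \in sqr_tens /\
  (forall i : 'I_n, tens2 u b`_i + tens2 b`_i u \in sqr_tens).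
suff [] : P (\sum_i coord b i v *: b`_i) by [].
have bmem (i : 'I_n) : b`_i \in (b : seq V) by rewrite mem_nth ?size_tuple.
elim: (index_enum _) => [|i s [IH1 IH2]]; rewrite ?big_nil ?big_cons.
  by split=> [|i]; rewrite ?tens2_0l ?tens2_0r ?addr0 mem0v.
set u := \sum_(j <- s) _ in IH1 IH2 *; set a := coord _ _ _; split=> [|j].
  rewrite !tens2Dl !tens2Dr !tens2Zl !tens2Zr.
  rewrite addrA -[X in X + _]addrA -scalerDr.
  apply: rpredD => //; apply: rpredD; first by rewrite !rpredZ // bsq.
  by rewrite rpredZ // addrC IH2.
rewrite tens2Dl tens2Dr tens2Zl tens2Zr addrACA -scalerDr.
by apply: rpredD => //; rewrite rpredZ // bsym.
Qed.

Lemma sqr_tens_map f X : X \in sqr_tens -> tens2_map f X \in sqr_tens.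
Proof.
move=> XS; have := memv_img (linfun (tens2_map f)) XS; rewrite lfunE /=.
suff /subvP sub : (linfun (tens2_map f) @: sqr_tens <= sqr_tens)%VS by move/sub.
rewrite limg_span.
apply/span_subvP => _ /mapP[_ /mapP[v _ ->] ->].
by rewrite lfunE /= tens2_mapE sqr_tensP.
Qed.

Definition ext2 := Quotient.quot (sqr_tens : zmodClosed _).
HB.instance Definition _ := GRing.Zmodule.on ext2.
HB.instance Definition _ := EqQuotient.on ext2.
HB.instance Definition _ := ZmodQuotient.on ext2.

Lemma ext2_eq X Y : (\pi_ext2 X == \pi_ext2 Y) = (X - Y \in sqr_tens).
Proof. exact/esym/(Quotient.idealrBE (sqr_tens : zmodClosed _)). Qed.

Definition ext2_scale (a : F) (x : ext2) : ext2 := \pi_ext2 (a *: repr x).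

Lemma pi_ext2_scale a X : \pi_ext2 (a *: X) = ext2_scale a (\pi_ext2 X).
Proof.
apply/eqP; rewrite ext2_eq -scalerBr rpredZ // -ext2_eq.
by rewrite reprK.
Qed.

Fact ext2_scaleA a c v : ext2_scale a (ext2_scale c v) = ext2_scale (a * c) v.
Proof.
by rewrite -[v]reprK -(pi_ext2_scale c) -(pi_ext2_scale a) -pi_ext2_scale scalerA.
Qed.
Fact ext2_scale1 : left_id 1 ext2_scale.
Proof. by move=> v; rewrite -[v]reprK -pi_ext2_scale scale1r. Qed.
Fact ext2_scaleDr : right_distributive ext2_scale +%R.
Proof.
move=> a u v; rewrite -[u]reprK -[v]reprK -raddfD -!pi_ext2_scale scalerDr.
by rewrite raddfD.
Qed.
Fact ext2_scaleDl v : {morph ext2_scale^~ v : a c / a + c}.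
Proof. by move=> a c; rewrite -[v]reprK -!pi_ext2_scale scalerDl raddfD. Qed.
HB.instance Definition _ := GRing.Zmodule_isLmodule.Build F ext2
  ext2_scaleA ext2_scale1 ext2_scaleDr ext2_scaleDl.

Definition wedge (u v : V) : ext2 := \pi_ext2 (tens2 u v).

Lemma wedgexx v : wedge v v = 0.
Proof.
have -> : 0 = \pi_ext2 0 by rewrite raddf0.
by apply/eqP; rewrite ext2_eq subr0 sqr_tensP.
Qed.

Definition ext2_map (f : 'End(V)) (x : ext2) : ext2 :=
  \pi_ext2 (tens2_map f (repr x)).

Lemma ext2_map_pi f X : ext2_map f (\pi_ext2 X) = \pi_ext2 (tens2_map f X).
Proof.
apply/eqP; rewrite ext2_eq -linearB; apply: sqr_tens_map.
by rewrite -ext2_eq reprK.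
Qed.

Lemma ext2_map_wedge f u v : ext2_map f (wedge u v) = wedge (f u) (f v).
Proof. by rewrite ext2_map_pi tens2_mapE. Qed.

End ExteriorSquare.

Section Zorn.
Variable F : fieldType.

Definition dot (u v : 'rV[F]_3) : F := \sum_i u 0 i * v 0 i.

(* The indices are taken modulo 3. *)
Definition cross (u v : 'rV[F]_3) : 'rV[F]_3 :=
  \row_i (u 0 (i + 1) * v 0 (i + 2%:R) - u 0 (i + 2%:R) * v 0 (i + 1)).

(* ((alpha, u), (v, beta)) lists the rows of the vector matrix. *)
Definition zorn : Type := (F^o * 'rV[F]_3) * ('rV[F]_3 * F^o).
HB.instance Definition _ := Vector.on zorn.

Definition zalpha (a : zorn) : F := a.1.1.
Definition zu (a : zorn) : 'rV[F]_3 := a.1.2.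
Definition zv (a : zorn) : 'rV[F]_3 := a.2.1.
Definition zbeta (a : zorn) : F := a.2.2.

Definition zmul (a b : zorn) : zorn :=
  ((zalpha a * zalpha b + dot (zu a) (zv b),
    zalpha a *: zu b + zbeta b *: zu a - cross (zv a) (zv b)),
   (zalpha b *: zv a + zbeta a *: zv b + cross (zu a) (zu b),
    zbeta a * zbeta b + dot (zv a) (zu b))).

Definition zone : zorn := ((1, 0), (0, 1)).

Definition znorm (a : zorn) : F := zalpha a * zbeta a - dot (zu a) (zv a).

Definition zq (a b : zorn) : F := znorm (a + b) - znorm a - znorm b.

Definition ztrace (a : zorn) : F^o := zalpha a + zbeta a.

Definition zrmul (x z : zorn) : zorn := zmul z x.

Fact ztrace_is_linear : linear ztrace.
Proof.
move=> c [[a u] [v b]] [[a' u'] [v' b']].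
by rewrite /ztrace /zalpha /zbeta /= scalerDr addrACA.
Qed.
HB.instance Definition _ := GRing.isLinear.Build F zorn F^o _ ztrace
  ztrace_is_linear.

Lemma dotE u v : dot u v = u 0 0 * v 0 0 + u 0 1 * v 0 1 + u 0 2%:R * v 0 2%:R.
Proof.
rewrite /dot !big_ord_recl big_ord0 addr0 addrA.
by do !congr (_ + _); congr (u 0 _ * v 0 _); apply: val_inj.
Qed.

Lemma cross0 u v : cross u v 0 0 = u 0 1 * v 0 2%:R - u 0 2%:R * v 0 1.
Proof. by rewrite mxE !add0r. Qed.
Lemma cross1 u v : cross u v 0 1 = u 0 2%:R * v 0 0 - u 0 0 * v 0 2%:R.
Proof.
rewrite mxE; have -> : (1 + 1 : 'I_3) = 2%:R by apply: val_inj.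
by have -> : (1 + 2%:R : 'I_3) = 0 by apply: val_inj.
Qed.
Lemma cross2 u v : cross u v 0 2%:R = u 0 0 * v 0 1 - u 0 1 * v 0 0.
Proof.
rewrite mxE; have -> : (2%:R + 1 : 'I_3) = 0 by apply: val_inj.
by have -> : (2%:R + 2%:R : 'I_3) = 1 by apply: val_inj.
Qed.

Lemma rV3P (u v : 'rV[F]_3) :
  u 0 0 = v 0 0 -> u 0 1 = v 0 1 -> u 0 2%:R = v 0 2%:R -> u = v.
Proof.
move=> e0 e1 e2; apply/rowP => i.
have [->|[->|->]] // : i = 0 \/ i = 1 \/ i = 2%:R.
by case: i => [[|[|[|i]]] lti] //; [left|right; left|right; right]; apply: val_inj.
Qed.

Lemma zornP (a b : zorn) : zalpha a = zalpha b -> zu a = zu b ->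
  zv a = zv b -> zbeta a = zbeta b -> a = b.
Proof.
by case: a b => [[a u] [v b]] [[a' u'] [v' b']]; rewrite /zalpha /zu /zv /zbeta
  /= => -> -> -> ->.
Qed.

Lemma zalphaD a b : zalpha (a + b) = zalpha a + zalpha b. Proof. by []. Qed.
Lemma zuD a b : zu (a + b) = zu a + zu b. Proof. by []. Qed.
Lemma zvD a b : zv (a + b) = zv a + zv b. Proof. by []. Qed.
Lemma zbetaD a b : zbeta (a + b) = zbeta a + zbeta b. Proof. by []. Qed.
Lemma zalphaZ c a : zalpha (c *: a) = c * zalpha a. Proof. by []. Qed.
Lemma zuZ c a : zu (c *: a) = c *: zu a. Proof. by []. Qed.
Lemma zvZ c a : zv (c *: a) = c *: zv a. Proof. by []. Qed.
Lemma zbetaZ c a : zbeta (c *: a) = c * zbeta a. Proof. by []. Qed.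
Lemma zalphaM a b : zalpha (zmul a b) = zalpha a * zalpha b + dot (zu a) (zv b).
Proof. by []. Qed.
Lemma zuM a b : zu (zmul a b) =
  zalpha a *: zu b + zbeta b *: zu a - cross (zv a) (zv b).
Proof. by []. Qed.
Lemma zvM a b : zv (zmul a b) =
  zalpha b *: zv a + zbeta a *: zv b + cross (zu a) (zu b).
Proof. by []. Qed.
Lemma zbetaM a b : zbeta (zmul a b) = zbeta a * zbeta b + dot (zv a) (zu b).
Proof. by []. Qed.
Lemma zalpha1 : zalpha zone = 1. Proof. by []. Qed.
Lemma zu1 : zu zone = 0. Proof. by []. Qed.
Lemma zv1 : zv zone = 0. Proof. by []. Qed.
Lemma zbeta1 : zbeta zone = 1. Proof. by []. Qed.

Definition zE := (zalphaD, zuD, zvD, zbetaD, zalphaZ, zuZ, zvZ, zbetaZ,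
  zalphaM, zuM, zvM, zbetaM, (zalpha1, zu1, zv1, zbeta1)).

Lemma rV3DE (u v : 'rV[F]_3) i : (u + v) 0 i = u 0 i + v 0 i.
Proof. by rewrite mxE. Qed.
Lemma rV3NE (u : 'rV[F]_3) i : (- u) 0 i = - u 0 i.
Proof. by rewrite mxE. Qed.
Lemma rV3ZE c (u : 'rV[F]_3) i : (c *: u) 0 i = c * u 0 i.
Proof. by rewrite mxE. Qed.
Lemma rV30E i : (0 : 'rV[F]_3) 0 i = 0.
Proof. by rewrite mxE. Qed.

Definition rV3E := (rV3DE, rV3NE, rV3ZE, rV30E, cross0, cross1, cross2).

Ltac zring := rewrite ?(dotE, zE, rV3E); ring.
Ltac zornring :=
  apply: zornP; [|apply: rV3P|apply: rV3P|]; zring.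

Fact zmul_is_linear x : linear (zmul x).
Proof. by move=> c a b; zornring. Qed.
HB.instance Definition _ x := GRing.isLinear.Build F zorn zorn _ (zmul x)
  (zmul_is_linear x).

Fact zrmul_is_linear x : linear (zrmul x).
Proof. by rewrite /zrmul => c a b; zornring. Qed.
HB.instance Definition _ x := GRing.isLinear.Build F zorn zorn _ (zrmul x)
  (zrmul_is_linear x).

Definition Lmul (x : zorn) : 'End(zorn) := linfun (zmul x).
Definition Rmul (x : zorn) : 'End(zorn) := linfun (zrmul x).

Lemma LmulE x z : Lmul x z = zmul x z.
Proof. by rewrite lfunE. Qed.
Lemma RmulE x z : Rmul x z = zmul z x.
Proof. by rewrite lfunE. Qed.

Lemma znormM a b : znorm (zmul a b) = znorm a * znorm b.
Proof. rewrite /znorm; zring. Qed.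

Lemma zmul_alt_l a z : zmul a (zmul a z) = zmul (zmul a a) z.
Proof. by zornring. Qed.
Lemma zmul_alt_r a z : zmul (zmul z a) a = zmul z (zmul a a).
Proof. by zornring. Qed.


Lemma zq_ZE a b : zq a b = zalpha a * zbeta b + zalpha b * zbeta a
  - dot (zu a) (zv b) - dot (zu b) (zv a).
Proof. rewrite /zq /znorm; zring. Qed.

Lemma zq0 a : zq a 0 = 0.
Proof.
have z0 : (zalpha 0 = 0) * (zbeta 0 = 0) * (zu 0 = 0) * (zv 0 = 0) by [].
rewrite zq_ZE !z0 !dotE !rV3E; ring.
Qed.

Lemma zqC a b : zq a b = zq b a.
Proof. rewrite !zq_ZE; ring. Qed.

Lemma zq_Lmul x a b : zq (zmul x a) (zmul x b) = znorm x * zq a b.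
Proof. rewrite !zq_ZE /znorm; zring. Qed.

Lemma zq_Rmul x a b : zq (zmul a x) (zmul b x) = znorm x * zq a b.
Proof. rewrite !zq_ZE /znorm; zring. Qed.

Lemma zq1 a : zq a zone = ztrace a.
Proof. rewrite zq_ZE /ztrace; zring. Qed.

Lemma zq_nondeg x : (forall y, zq x y = 0) -> x = 0.
Proof.
move=> x0.
have d00 : (delta_mx 0 0 : 'rV[F]_3) 0 0 = 1 by rewrite mxE.
have d01 : (delta_mx 0 0 : 'rV[F]_3) 0 1 = 0 by rewrite mxE.
have d02 : (delta_mx 0 0 : 'rV[F]_3) 0 2%:R = 0 by rewrite mxE.
have d10 : (delta_mx 0 1 : 'rV[F]_3) 0 0 = 0 by rewrite mxE.
have d11 : (delta_mx 0 1 : 'rV[F]_3) 0 1 = 1 by rewrite mxE.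
have d12 : (delta_mx 0 1 : 'rV[F]_3) 0 2%:R = 0 by rewrite mxE.
have d20 : (delta_mx 0 2%:R : 'rV[F]_3) 0 0 = 0 by rewrite mxE.
have d21 : (delta_mx 0 2%:R : 'rV[F]_3) 0 1 = 0 by rewrite mxE.
have d22 : (delta_mx 0 2%:R : 'rV[F]_3) 0 2%:R = 1 by rewrite mxE.
have dE := (d00, d01, d02, d10, d11, d12, d20, d21, d22).
have E (al be : F) (u v : 'rV[F]_3) : zalpha x * be + al * zbeta x
    - dot (zu x) v - dot u (zv x) = 0.
  by rewrite -(x0 ((al, u), (v, be))) zq_ZE.
have z0 : (zalpha 0 = 0) * (zbeta 0 = 0) * (zu 0 = 0) * (zv 0 = 0) by [].
have t := (dotE, rV3E, dE).
apply: zornP; [|apply: rV3P|apply: rV3P|]; rewrite ?z0 ?rV30E.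
- by apply: etrans (E 0 1 0 0); rewrite !t; ring.
- by apply: etrans (E 0 0 0 (- delta_mx 0 0)); rewrite !t; ring.
- by apply: etrans (E 0 0 0 (- delta_mx 0 1)); rewrite !t; ring.
- by apply: etrans (E 0 0 0 (- delta_mx 0 2%:R)); rewrite !t; ring.
- by apply: etrans (E 0 0 (- delta_mx 0 0) 0); rewrite !t; ring.
- by apply: etrans (E 0 0 (- delta_mx 0 1) 0); rewrite !t; ring.
- by apply: etrans (E 0 0 (- delta_mx 0 2%:R) 0); rewrite !t; ring.
- by apply: etrans (E 1 0 0 0); rewrite !t; ring.
Qed.

End Zorn.

Section Determinant.
Variables (F : fieldType) (V : vectType F).

Definition lfun_det (f : 'End(V)) : F :=
  \det (mxof (vbasis {:V}) (vbasis {:V}) f).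

Lemma lfun_det1 : lfun_det \1 = 1.
Proof.
by rewrite /lfun_det mxof1 ?det1 // (basis_free (vbasisP _)).
Qed.

Lemma lfun_detM f g : lfun_det (f \o g)%VF = lfun_det f * lfun_det g.
Proof.
rewrite /lfun_det (mxof_comp (vbasis {:V}) (vbasis {:V}) (vbasisP _)).
by rewrite det_mulmx mulrC.
Qed.

Lemma lfun_detN f : lfun_det (- f) = (-1) ^+ \dim {:V} * lfun_det f.
Proof. by rewrite /lfun_det linearN /= -scaleN1r detZ. Qed.
End Determinant.

Section SO8.
Variable F : fieldType.
Local Notation O := (zorn F).

(* zq is bilinear and nondegenerate, so the first condition says that g lies in
   the orthogonal group O(O, q). *)
Definition is_SO8 (g : 'End(O)) : bool :=
  `[< forall x y, zq (g x) (g y) = zq x y >] && (lfun_det g == 1).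

Record SO8 : Type := MkSO8 { so8_val :> 'End(O); _ : is_SO8 so8_val }.
HB.instance Definition _ := [isSub for so8_val].
HB.instance Definition _ := [Choice of SO8 by <:].

Lemma SO8P (g : SO8) x y : zq (g x) (g y) = zq x y.
Proof. by case: g => g /= /andP[/asboolP ->]. Qed.

Lemma SO8_det (g : SO8) : lfun_det g = 1.
Proof. by case: g => g /= /andP[_ /eqP]. Qed.

Lemma SO8_ker (g : SO8) : lker g == 0%VS.
Proof.
rewrite -subv0; apply/subvP => x; rewrite memv_ker memv0 => /eqP gx.
apply/eqP/zq_nondeg => y; by rewrite -(SO8P g) gx zqC zq0.
Qed.

Fact SO8_one_subproof : is_SO8 \1%VF.
Proof.
by apply/andP; split; [apply/asboolP => x y; rewrite !lfunE|rewrite lfun_det1].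
Qed.

Fact SO8_mul_subproof (g h : SO8) : is_SO8 (g \o h)%VF.
Proof.
apply/andP; split; last by rewrite lfun_detM !SO8_det mulr1.
by apply/asboolP => x y; rewrite !comp_lfunE !SO8P.
Qed.

Fact SO8_inv_subproof (g : SO8) : is_SO8 (g^-1)%VF.
Proof.
have gK := lker0_compfV (SO8_ker g); apply/andP; split.
  apply/asboolP => x y; rewrite -(SO8P g).
  by rewrite -!comp_lfunE gK !id_lfunE.
have /eqP := lfun_detM g (g^-1)%VF.
by rewrite gK lfun_det1 SO8_det mul1r eq_sym.
Qed.

Definition SO8_one := MkSO8 SO8_one_subproof.
Definition SO8_mul g h := MkSO8 (SO8_mul_subproof g h).
Definition SO8_inv g := MkSO8 (SO8_inv_subproof g).

Fact SO8_mulA : associative SO8_mul.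
Proof. by move=> f g h; apply: val_inj; rewrite /= comp_lfunA. Qed.
Fact SO8_mul1g : left_id SO8_one SO8_mul.
Proof. by move=> g; apply: val_inj; rewrite /= comp_lfun1l. Qed.
Fact SO8_mulg1 : right_id SO8_one SO8_mul.
Proof. by move=> g; apply: val_inj; rewrite /= comp_lfun1r. Qed.
Fact SO8_mulVg : left_inverse SO8_one SO8_inv SO8_mul.
Proof. by move=> g; apply: val_inj; rewrite /= lker0_compVf ?SO8_ker. Qed.
Fact SO8_mulgV : right_inverse SO8_one SO8_inv SO8_mul.
Proof. by move=> g; apply: val_inj; rewrite /= lker0_compfV ?SO8_ker. Qed.
HB.instance Definition _ := isGroup.Build SO8
  SO8_mulA SO8_mul1g SO8_mulg1 SO8_mulVg SO8_mulgV.

Definition SO7 : {pred SO8} := [pred g : SO8 | g (zone F) == zone F].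

Definition pm_eq (g h : SO8) : bool :=
  (so8_val g == so8_val h) || (so8_val g == - so8_val h).

Fact pm_eq_equiv : equiv_class_of pm_eq.
Proof.
split=> [g|g h|h g k]; rewrite /pm_eq ?eqxx //.
  by congr (_ || _); [exact: eq_sym | rewrite -eqr_oppLR eq_sym].
case/orP=> /eqP ->; case/orP=> /eqP ->;
  by rewrite ?opprK ?eqxx ?orbT.
Qed.
Canonical pm_eq_rel := EquivRelPack pm_eq_equiv.
Canonical pm_eq_encModRel := defaultEncModRel pm_eq.

Definition PSO8 : Type := {eq_quot pm_eq}.
HB.instance Definition _ := Choice.on PSO8.
HB.instance Definition _ := EqQuotient.on PSO8.

Lemma PSO8_eq g h : (\pi_PSO8 g == \pi_PSO8 h) = pm_eq g h.
Proof. by rewrite piE. Qed.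

Definition PSO8_one : PSO8 := \pi_PSO8 1%g.
Definition PSO8_mul (a b : PSO8) : PSO8 := \pi_PSO8 (repr a * repr b)%g.
Definition PSO8_inv (a : PSO8) : PSO8 := \pi_PSO8 (repr a)^-1%g.

Lemma pi_PSO8M g h : \pi_PSO8 (g * h)%g = PSO8_mul (\pi_PSO8 g) (\pi_PSO8 h).
Proof.
apply/eqP; rewrite PSO8_eq.
have := reprK (\pi_PSO8 g); have := reprK (\pi_PSO8 h).
move=> /eqP; rewrite PSO8_eq => h'; move=> /eqP; rewrite PSO8_eq.
move: h'; rewrite /pm_eq /= => /orP[]/eqP-> /orP[]/eqP->;
by rewrite ?(comp_lfunNl, comp_lfunNr, opprK, eqxx, orbT).
Qed.

Lemma pi_PSO8V g : \pi_PSO8 g^-1%g = PSO8_inv (\pi_PSO8 g).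
Proof.
apply/eqP; rewrite /PSO8_inv; set h := repr _.
have e : pm_eq h g by rewrite -PSO8_eq reprK.
move: h e => h e.
rewrite PSO8_eq /pm_eq; case/orP: e => /eqP e.
  by rewrite /= e eqxx.
apply/orP; right; apply/eqP => /=.
have hK : (h \o h^-1)%VF = \1%VF by rewrite lker0_compfV ?SO8_ker.
have gK : (g^-1 \o g)%VF = \1%VF by rewrite lker0_compVf ?SO8_ker.
move: (so8_val h)^-1%VF (so8_val g)^-1%VF hK gK => h' g' hK gK.
by rewrite -[LHS]comp_lfun1r -hK comp_lfunA e comp_lfunNr gK comp_lfunNl
  comp_lfun1l.
Qed.

Fact PSO8_mulA : associative PSO8_mul.
Proof.
move=> a b c; rewrite -[a]reprK -[b]reprK -[c]reprK.
by rewrite -(pi_PSO8M (repr b)) -(pi_PSO8M (repr a) (repr b)) -!pi_PSO8M mulgA.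
Qed.
Fact PSO8_mul1g : left_id PSO8_one PSO8_mul.
Proof. by move=> a; rewrite -[a]reprK -pi_PSO8M mul1g. Qed.
Fact PSO8_mulg1 : right_id PSO8_one PSO8_mul.
Proof. by move=> a; rewrite -[a]reprK -pi_PSO8M mulg1. Qed.
Fact PSO8_mulVg : left_inverse PSO8_one PSO8_inv PSO8_mul.
Proof. by move=> a; rewrite -[a]reprK -pi_PSO8V -pi_PSO8M mulVg. Qed.
Fact PSO8_mulgV : right_inverse PSO8_one PSO8_inv PSO8_mul.
Proof. by move=> a; rewrite -[a]reprK -pi_PSO8V -pi_PSO8M mulgV. Qed.
HB.instance Definition _ := isGroup.Build PSO8
  PSO8_mulA PSO8_mul1g PSO8_mulg1 PSO8_mulVg PSO8_mulgV.

Definition PSO8_act (a : PSO8) : ext2 O -> ext2 O := ext2_map (repr a).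

Lemma PSO8_act_pi g : PSO8_act (\pi_PSO8 g) =1 ext2_map g.
Proof.
move=> x; rewrite /PSO8_act; set h := repr _.
have e : pm_eq h g by rewrite -PSO8_eq reprK.
move: h e => h e.
case/orP: e => /eqP -> //.
rewrite /ext2_map /tens2_map; congr (\pi _).
by rewrite [mxof _ _ _]linearN [(- _)^T]linearN !mulNmx mulmxN opprK.
Qed.

(* The default 1 is never used on norm 1 elements: see val_SO8_L, val_SO8_R. *)
Definition SO8_L (x : O) : SO8 := insubd (1%g : SO8) (Lmul x).
Definition SO8_R (x : O) : SO8 := insubd (1%g : SO8) (Rmul x).

Definition PSO8_L (x : O) : PSO8 := \pi_PSO8 (SO8_L x).
Definition PSO8_R (x : O) : PSO8 := \pi_PSO8 (SO8_R x).
Definition PSO8_P (x : O) : PSO8 := ((PSO8_L x)^-1 * (PSO8_R x)^-1)%g.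

(* PSO8_L x, PSO8_R x and PSO8_P x only depend on the class of x modulo +-1. *)
Definition triality (rho : PSO8 -> PSO8) : Prop :=
  [/\ bijective rho,
      {morph rho : a b / (a * b)%g},
      (forall a, rho (rho (rho a)) = a) /\ (exists a, rho a <> a)
    & forall x, znorm x = 1 ->
        [/\ rho (PSO8_R x) = PSO8_P x, rho (PSO8_L x) = PSO8_R x
          & rho (PSO8_P x) = PSO8_L x]].

Definition O0 : {vspace O} := lker (linfun (@ztrace F)).

Lemma mem_O0 a : (a \in O0) = (ztrace a == 0).
Proof. by rewrite memv_ker lfunE. Qed.

Definition resO0 (g : SO8) : 'End(subvs_of O0) :=
  linfun (vsproj O0 \o (g \o vsval)).

Lemma resO0E g u : g \in SO7 -> vsval (resO0 g u) = g (vsval u).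
Proof.
move=> /eqP g1; rewrite lfunE /= vsprojK // mem_O0 -zq1 -[X in zq _ X]g1 SO8P zq1.
by rewrite -mem_O0 subvsP.
Qed.

End SO8.

Section NormOne.
Variable F : fieldType.
Local Notation O := (zorn F).
Local Notation b := (vbasis {:O}).

Lemma zqDZ (a x y : O) c : zq a (c *: x + y) = c * zq a x + zq a y.
Proof. rewrite !zq_ZE ?(dotE, zE, rV3E); ring. Qed.

Lemma zq_sum (I : finType) (a : O) (c : I -> F) (x : I -> O) :
  zq a (\sum_i c i *: x i) = \sum_i c i * zq a (x i).
Proof.
elim/big_rec2: _ => [|i u v _ <-]; first exact: zq0.
by rewrite zqDZ.
Qed.

Lemma isom_det2 (g : 'End(O)) :
  (forall x y, zq (g x) (g y) = zq x y) -> lfun_det g ^+ 2 = 1.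
Proof.
move=> gq; have bB : basis_of {:O} b := vbasisP _.
pose G : 'M[F]_(\dim {:O}) := \matrix_(i, j) zq b`_i b`_j.
have eG x y : zq x y = (rVof b x *m G *m (rVof b y)^T) 0 0.
  rewrite {1}(coord_vbasis (memvf y)) zq_sum mxE; apply: eq_bigr => j _.
  rewrite mulrC !mxE zqC {1}(coord_vbasis (memvf x)) zq_sum; congr (_ * _).
  by apply: eq_bigr => i _; rewrite !mxE zqC.
move: G eG => G eG.
have G0 : \det G != 0.
  apply/det0P => -[v /negP v0 vG]; apply: v0.
  rewrite -(vecofK bB v) (rVof_eq0 bB).
  apply/eqP/zq_nondeg => y.
  by rewrite eG vecofK ?bB // vG mul0mx mxE.
pose M := mxof b b g.
have MG : M *m G *m M^T = G.
  apply/matrixP => i j.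
  have E (A : 'M[F]_(\dim {:O})) : A i j =
      ((delta_mx 0 i : 'rV_(\dim {:O})) *m A *m
       (delta_mx 0 j : 'rV_(\dim {:O}))^T) 0 0.
    by rewrite -rowE trmx_delta -colE !mxE.
  rewrite E [RHS]E.
  have rg v : rVof b (g (vecof b v)) = v *m M.
    by rewrite /M mul_mxof.
  have H (u w : 'rV_(\dim {:O})) : (u *m M *m G *m (w *m M)^T) 0 0 = (u *m G *m w^T) 0 0.
    rewrite -!rg -eG gq eG; congr ((_ *m _ *m _^T) 0 0); exact: vecofK.
  rewrite -H trmx_mul !mulmxA; congr ((_ *m _) 0 0).
have /eqP := congr1 determinant MG.
rewrite !det_mulmx det_tr mulrAC -[X in _ == X]mul1r (inj_eq (mulIf G0)).
by rewrite -expr2 => /eqP.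
Qed.

Lemma zmul_add1 (x : O) : zmul (x + zone F) (x + zone F) =
  (ztrace x + 2%:R) *: x + (1 - znorm x) *: zone F.
Proof.
rewrite /ztrace /znorm.
by apply: zornP; [|apply: rV3P|apply: rV3P|];
  rewrite ?(dotE, zE, rV3E); ring.
Qed.

Lemma znorm_add1 (x : O) : znorm (x + zone F) = znorm x + ztrace x + 1.
Proof. rewrite /ztrace /znorm ?(dotE, zE, rV3E); ring. Qed.

Lemma znormZ c (x : O) : znorm (c *: x) = c ^+ 2 * znorm x.
Proof. rewrite /znorm ?(dotE, zE, rV3E); ring. Qed.

Lemma zmulZZ c (x y : O) : zmul (c *: x) (c *: y) = c ^+ 2 *: zmul x y.
Proof.
by apply: zornP; [|apply: rV3P|apply: rV3P|];
  rewrite ?(dotE, zE, rV3E); ring.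
Qed.

Lemma dim_zorn : \dim {:O} = 8%N.
Proof. by rewrite dimvf. Qed.

End NormOne.

Section ClosedField.
Variable F : closedFieldType.
Local Notation O := (zorn F).
Hypothesis F2 : 2%N \notin [pchar F].

Let two_neq0 : 2%:R != 0 :> F.
Proof. by move: F2; rewrite inE. Qed.

Lemma sqrt_norm1 (x : O) : znorm x = 1 -> ztrace x + 2%:R != 0 ->
  exists2 y, znorm y = 1 & x = zmul y y.
Proof.
move=> nx tx.
have [s s2] : exists s : F, s ^+ 2 = ztrace x + 2%:R.
  have [s] := @solve_monicpoly F 2
    (fun i => if i == 0%N then ztrace x + 2%:R else 0) isT.
  rewrite !big_ord_recl big_ord0 /= expr0 mulr1 mul0r !addr0 => s2.
  by exists s.
exists (s^-1 *: (x + zone F)).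
  rewrite znormZ znorm_add1 nx exprVn s2.
  have -> : 1 + ztrace x + 1 = ztrace x + 2%:R by rewrite addrC addrA addrC.
  by rewrite mulVf.
by rewrite zmulZZ zmul_add1 nx subrr scale0r addr0 scalerA exprVn s2 mulVf ?scale1r.
Qed.

Lemma mul_norm1_det (M : O -> 'End(O)) :
    (forall x a c, znorm x = 1 -> zq (M x a) (M x c) = zq a c) ->
    (forall x, M (zmul x x) = (M x \o M x)%VF) ->
    (forall x, M (- x) = - M x) ->
  forall x, znorm x = 1 -> lfun_det (M x) = 1.
Proof.
move=> Mq MM MN x nx.
have sq z : znorm z = 1 -> ztrace z + 2%:R != 0 -> lfun_det (M z) = 1.
  move=> nz /(sqrt_norm1 nz)[y ny ->]; rewrite MM lfun_detM -expr2.
  by apply: isom_det2 => a c; apply: Mq.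
have [/eqP t0|] := boolP (ztrace x + 2%:R == 0); last exact: sq.
have nNx : znorm (- x) = 1 by rewrite -scaleN1r znormZ nx sqrrN expr1n mulr1.
have : lfun_det (M (- x)) = 1.
  apply: sq => //; rewrite raddfN /=.
  have -> : ztrace x = - 2%:R by apply/eqP; rewrite -addr_eq0 t0.
  by rewrite opprK -natrD (natrM F 2 2) mulf_neq0.
by rewrite MN lfun_detN dim_zorn -signr_odd expr0 mul1r.
Qed.

Lemma val_SO8_L (x : O) : znorm x = 1 -> so8_val (SO8_L x) = Lmul x.
Proof.
move=> nx; rewrite /SO8_L insubdK //; apply/andP; split.
  by apply/asboolP => a c; rewrite !LmulE zq_Lmul nx mul1r.
apply/eqP; apply: mul_norm1_det nx => [y a c ny|y|y].
- by rewrite !LmulE zq_Lmul ny mul1r.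
- by apply/lfunP => z; rewrite comp_lfunE !LmulE zmul_alt_l.
- apply/lfunP => z; rewrite opp_lfunE !LmulE -!scaleN1r.
  by apply: zornP; [|apply: rV3P|apply: rV3P|];
    rewrite ?(dotE, zE, rV3E); ring.
Qed.

Lemma val_SO8_R (x : O) : znorm x = 1 -> so8_val (SO8_R x) = Rmul x.
Proof.
move=> nx; rewrite /SO8_R insubdK //; apply/andP; split.
  by apply/asboolP => a c; rewrite !RmulE zq_Rmul nx mul1r.
apply/eqP; apply: mul_norm1_det nx => [y a c ny|y|y].
- by rewrite !RmulE zq_Rmul ny mul1r.
- by apply/lfunP => z; rewrite comp_lfunE !RmulE zmul_alt_r.
- apply/lfunP => z; rewrite opp_lfunE !RmulE -!scaleN1r.
  by apply: zornP; [|apply: rV3P|apply: rV3P|];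
    rewrite ?(dotE, zE, rV3E); ring.
Qed.

End ClosedField.

(* Main.v *)
Require Import Defs.
From HB Require Import structures.
From mathcomp Require Import all_boot all_order all_algebra.
From mathcomp Require Import ring.

Import GRing.Theory.
Local Open Scope ring_scope.
Local Open Scope quotient_scope.

Set Implicit Arguments.
Unset Strict Implicit.
Unset Printing Implicit Defensive.

Import passmx.

(** The exterior square of the octonions O, with the untwisted action, is the
    adjoint module of SO(O, q), the bivector u ^ v being the skew operator
    z |-> q(z, u) v - q(z, v) u. The differential of the triality automorphism
    is therefore a linear automorphism of this module that turns the action
    twisted by triality into the untwisted one. Over SO(7) the untwisted module
    splits, since O is the orthogonal sum of the line of 1 and of O_0: the
    bivectors 1 ^ a give a copy of O_0, the others the exterior square of O_0.

    No Lie algebra is needed, because the differential (of the inverse of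
    triality, up to a scalar) has a closed formula: it sends u ^ v to the
    operator [spin u v], which is R_v* R_u - R_u* R_v, read back as a bivector
    by means of a pair of dual bases of O. This is [triality_map]. Three facts
    make the proof work.

    - Equivariance. The Moufang identities say how [spin] changes when u and v
      are multiplied by an octonion x of norm 1: multiplying on the right
      conjugates the operator by L_x ([spinRL]), multiplying on the left
      conjugates it by P_x ([spinLP]). These are the values of the inverse of
      triality at R_x and L_x.

    - Generation. The hypotheses on triality only give its values at the L_x
      and the R_x, so one needs that these generate SO(8) ([SO8_ind_LR]). The
      Cartan-Dieudonne argument writes an isometry as a product of reflections;
      the reflection in a vector a of norm 1 is L_-a R_a composed with octonion
      conjugation, and conjugation has determinant -1, so that it occurs an
      even number of times.

    - Bijectivity. Triality and conjugation by the octonion conjugation C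
      generate a symmetric group of degree 3, in which their product is an
      involution. For the linear map T at hand this becomes T C T = 16 C
      ([triality_map_conj]), so that T is invertible in characteristic other
      than 2. *)

(** * The universal property of the exterior square *)

Section Alternating.
Variables (F : fieldType) (V : vectType F) (W : lmodType F).

Record alternating := Alternating {
  alt_fun :> V -> V -> W;
  alt_linearl : forall v, linear (alt_fun^~ v);
  alt_linearr : forall u, linear (alt_fun u);
  alt_diag : forall v, alt_fun v v = 0 }.

Variable beta : alternating.
Local Notation b := (vbasis {:V}).

Lemma alt_sumr (I : Type) (r : seq I) (c : I -> F) (x : I -> V) u :
  beta u (\sum_(i <- r) c i *: x i) = \sum_(i <- r) c i *: beta u (x i).
Proof.
pose f : {linear V -> W} :=
  HB.pack (beta u) (GRing.isLinear.Build F V W *:%R (beta u) (alt_linearr beta u)).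
by rewrite -[beta u]/(f : V -> W) linear_sum; apply: eq_bigr => i _; rewrite linearZ.
Qed.

Lemma alt_suml (I : Type) (r : seq I) (c : I -> F) (x : I -> V) v :
  beta (\sum_(i <- r) c i *: x i) v = \sum_(i <- r) c i *: beta (x i) v.
Proof.
pose f : {linear V -> W} := HB.pack (beta^~ v)
  (GRing.isLinear.Build F V W *:%R (beta^~ v) (alt_linearl beta v)).
by rewrite -[LHS]/(f _) linear_sum; apply: eq_bigr => i _; rewrite linearZ.
Qed.

Definition tens2_lift (X : 'M[F]_(\dim {:V})) : W :=
  \sum_i \sum_j X i j *: beta b`_i b`_j.

Fact tens2_lift_is_linear : linear tens2_lift.
Proof.
move=> a X Y; rewrite /tens2_lift scaler_sumr -big_split; apply: eq_bigr => i _ /=.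
rewrite scaler_sumr -big_split; apply: eq_bigr => j _ /=.
by rewrite !mxE scalerDl scalerA.
Qed.
HB.instance Definition _ := GRing.isLinear.Build F 'M[F]_(\dim {:V}) W _
  tens2_lift tens2_lift_is_linear.

Lemma tens2_liftE u v : tens2_lift (tens2 u v) = beta u v.
Proof.
rewrite [in RHS](coord_vbasis (memvf u)) alt_suml; apply: eq_bigr => i _.
rewrite [in RHS](coord_vbasis (memvf v)) alt_sumr scaler_sumr.
by apply: eq_bigr => j _; rewrite !mxE big_ord1 !mxE scalerA.
Qed.

(** The squares that span the ideal are squares v (x) v of vectors, so that only
    the diagonal values of the form matter. *)
Lemma tens2_lift_sqr X : X \in sqr_tens V -> tens2_lift X = 0.
Proof.
rewrite /sqr_tens; set s := map _ _ => /(@coord_span _ _ _ (in_tuple s)) ->.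
rewrite linear_sum big1 // => i _; rewrite linearZ /=.
have /mapP[v _ ->] : s`_i \in s by rewrite mem_nth.
by rewrite tens2_liftE alt_diag scaler0.
Qed.

Definition ext2_lift (x : ext2 V) : W := tens2_lift (repr x).

Lemma ext2_lift_pi X : ext2_lift (\pi_(ext2 V) X) = tens2_lift X.
Proof.
apply/eqP; rewrite -subr_eq0 -linearB; apply/eqP/tens2_lift_sqr.
by rewrite -ext2_eq reprK.
Qed.

Fact ext2_lift_is_linear : linear ext2_lift.
Proof.
move=> a x y; rewrite -[x]reprK -[y]reprK -[a *: _]pi_ext2_scale -raddfD.
by rewrite !ext2_lift_pi linearP.
Qed.
HB.instance Definition _ := GRing.isLinear.Build F (ext2 V) W _
  ext2_lift ext2_lift_is_linear.

Lemma ext2_liftE u v : ext2_lift (wedge u v) = beta u v.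
Proof. by rewrite ext2_lift_pi tens2_liftE. Qed.

End Alternating.

Section ExteriorSquare.
Variables (F : fieldType) (V : vectType F).
Local Notation b := (vbasis {:V}).

Lemma pi_ext2Z a X : \pi_(ext2 V) (a *: X) = a *: \pi_(ext2 V) X.
Proof. exact: pi_ext2_scale. Qed.

Fact wedge_linearl (v : V) : linear (@wedge F V ^~ v).
Proof.
by move=> a x y; rewrite /wedge tens2Dl tens2Zl raddfD /= pi_ext2_scale.
Qed.
Fact wedge_linearr (v : V) : linear (wedge v).
Proof.
by move=> a x y; rewrite /wedge tens2Dr tens2Zr raddfD /= pi_ext2_scale.
Qed.

Definition wedge_alt := Alternating wedge_linearl wedge_linearr (@wedgexx F V).

HB.instance Definition _ v := GRing.isLinear.Build F V (ext2 V) _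
  (wedge v) (wedge_linearr v).

Lemma wedgeBl c (x y z : V) :
  wedge (x - c *: y) z = wedge x z - c *: wedge y z.
Proof. by rewrite addrC -scaleNr [LHS]wedge_linearl scaleNr addrC. Qed.

Lemma wedgeBr c (x y z : V) :
  wedge z (x - c *: y) = wedge z x - c *: wedge z y.
Proof. by rewrite linearB linearZ. Qed.

Lemma wedge0l (v : V) : wedge 0 v = 0.
Proof. by have := wedgeBl 1 v v v; rewrite scale1r subrr wedgexx scaler0 subr0. Qed.

Lemma wedgeC (u v : V) : wedge u v = - wedge v u.
Proof.
apply/eqP; rewrite -addr_eq0; apply/eqP.
have wD x y z : wedge (x + y) z = wedge x z + wedge y z :> ext2 V.
  by have := wedge_linearl z 1 x y; rewrite !scale1r.
have := wedgexx (u + v).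
by rewrite wD !linearD /= !wedgexx add0r addr0.
Qed.

(** The products of basis vectors already span the tensor square. *)
Lemma eq_ext2 (W : lmodType F) (f g : {linear ext2 V -> W}) :
  (forall u v, f (wedge u v) = g (wedge u v)) -> f =1 g.
Proof.
move=> fg x; rewrite -[x]reprK [repr x]matrix_sum_delta.
rewrite 2!raddf_sum /= raddf_sum; apply: eq_bigr => i _ /=.
rewrite !raddf_sum; apply: eq_bigr => j _ /=.
rewrite pi_ext2Z !linearZ /=; congr (_ *: _).
suff -> : delta_mx i j = tens2 (b`_i : V) b`_j by apply: fg.
by rewrite /tens2 !(rVofE (vbasisP _)) trmx_delta mul_delta_mx.
Qed.

Fact ext2_map_is_linear (f : 'End(V)) : linear (ext2_map f).
Proof.
move=> a x y; rewrite -[x]reprK -[y]reprK -[a *: _]pi_ext2_scale -raddfD.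
by rewrite !ext2_map_pi linearP raddfD /= pi_ext2_scale.
Qed.
HB.instance Definition _ f := GRing.isLinear.Build F (ext2 V) (ext2 V) _
  (ext2_map f) (ext2_map_is_linear f).

Lemma ext2_map_comp (f g : 'End(V)) x :
  ext2_map (f \o g)%VF x = ext2_map f (ext2_map g x).
Proof.
apply: (eq_ext2 (f := ext2_map (f \o g)%VF) (g := ext2_map f \o ext2_map g)) x.
by move=> u v; rewrite /= !ext2_map_wedge !comp_lfunE.
Qed.

Lemma ext2_map1 x : ext2_map (\1%VF : 'End(V)) x = x.
Proof.
apply: (eq_ext2 (f := ext2_map \1%VF) (g := idfun)) x => u v.
by rewrite /= ext2_map_wedge !id_lfunE.
Qed.

End ExteriorSquare.

Section Functor.
Variables (F : fieldType) (V W : vectType F) (f : {linear V -> W}).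

Fact wedge2_linearl v : linear (fun u => wedge (f u) (f v)).
Proof. by move=> a x y; rewrite linearP [LHS]wedge_linearl. Qed.
Fact wedge2_linearr u : linear (fun v => wedge (f u) (f v)).
Proof. by move=> a x y; rewrite linearP [LHS]wedge_linearr. Qed.
Fact wedge2_diag v : wedge (f v) (f v) = 0. Proof. exact: wedgexx. Qed.

Definition ext2_functor : ext2 V -> ext2 W :=
  ext2_lift (Alternating wedge2_linearl wedge2_linearr wedge2_diag).
HB.instance Definition _ := GRing.Linear.on ext2_functor.

Lemma ext2_functorE u v : ext2_functor (wedge u v) = wedge (f u) (f v).
Proof. exact: ext2_liftE. Qed.

End Functor.

(** * Octonions in coordinates *)

Section Coordinates.
Variable F : fieldType.
Local Notation O := (zorn F).
Local Notation "x ** y" := (zmul x y) (at level 40, left associativity).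

Definition row3 (a b c : F) : 'rV[F]_3 := \row_i [:: a; b; c]`_i.

Lemma row3E a b c :
  (row3 a b c 0 0 = a) * (row3 a b c 0 1 = b) * (row3 a b c 0 2%:R = c).
Proof. by rewrite !mxE. Qed.

(** Vectors of length 3 are sealed matrices, on which nothing computes: this
    constructor exposes all eight coordinates to rewriting. *)
Definition octo (a u0 u1 u2 v0 v1 v2 b : F) : O :=
  ((a, row3 u0 u1 u2), (row3 v0 v1 v2, b)).

Lemma octoP (P : O -> Prop) :
    (forall a u0 u1 u2 v0 v1 v2 b, P (octo a u0 u1 u2 v0 v1 v2 b)) ->
  forall z, P z.
Proof.
move=> H [[a u] [v b]].
have E (w : 'rV[F]_3) : w = row3 (w 0 0) (w 0 1) (w 0 2%:R).
  by apply: rV3P; rewrite row3E.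
by rewrite (E u) (E v); apply: H.
Qed.

Definition zconj (a : O) : O := ((zbeta a, - zu a), (- zv a, zalpha a)).

Ltac coords :=
  apply: zornP => /=; try apply: rV3P; rewrite ?(dotE, zE, rV3E, row3E).

Lemma octo_conj a u0 u1 u2 v0 v1 v2 b :
  zconj (octo a u0 u1 u2 v0 v1 v2 b) =
  octo b (- u0) (- u1) (- u2) (- v0) (- v1) (- v2) a.
Proof. by coords. Qed.

Lemma octoD a u0 u1 u2 v0 v1 v2 b a' u0' u1' u2' v0' v1' v2' b' :
  octo a u0 u1 u2 v0 v1 v2 b + octo a' u0' u1' u2' v0' v1' v2' b' =
  octo (a + a') (u0 + u0') (u1 + u1') (u2 + u2')
       (v0 + v0') (v1 + v1') (v2 + v2') (b + b').
Proof. by coords. Qed.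

Lemma octoZ c a u0 u1 u2 v0 v1 v2 b :
  c *: octo a u0 u1 u2 v0 v1 v2 b =
  octo (c * a) (c * u0) (c * u1) (c * u2) (c * v0) (c * v1) (c * v2) (c * b).
Proof. by coords. Qed.

Lemma octoN a u0 u1 u2 v0 v1 v2 b :
  - octo a u0 u1 u2 v0 v1 v2 b =
  octo (- a) (- u0) (- u1) (- u2) (- v0) (- v1) (- v2) (- b).
Proof. by coords. Qed.

Lemma octo1 : zone F = octo 1 0 0 0 0 0 0 1.
Proof. by coords. Qed.

Lemma octoM a u0 u1 u2 v0 v1 v2 b a' u0' u1' u2' v0' v1' v2' b' :
  octo a u0 u1 u2 v0 v1 v2 b ** octo a' u0' u1' u2' v0' v1' v2' b' =
  octo (a * a' + (u0 * v0' + u1 * v1' + u2 * v2'))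
       (a * u0' + b' * u0 - (v1 * v2' - v2 * v1'))
       (a * u1' + b' * u1 - (v2 * v0' - v0 * v2'))
       (a * u2' + b' * u2 - (v0 * v1' - v1 * v0'))
       (a' * v0 + b * v0' + (u1 * u2' - u2 * u1'))
       (a' * v1 + b * v1' + (u2 * u0' - u0 * u2'))
       (a' * v2 + b * v2' + (u0 * u1' - u1 * u0'))
       (b * b' + (v0 * u0' + v1 * u1' + v2 * u2')).
Proof. by coords. Qed.

Lemma octo_q a u0 u1 u2 v0 v1 v2 b a' u0' u1' u2' v0' v1' v2' b' :
  zq (octo a u0 u1 u2 v0 v1 v2 b) (octo a' u0' u1' u2' v0' v1' v2' b') =
  a * b' + a' * b - (u0 * v0' + u1 * v1' + u2 * v2')
    - (u0' * v0 + u1' * v1 + u2' * v2).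
Proof. by rewrite zq_ZE !dotE !row3E. Qed.

Lemma octo_norm a u0 u1 u2 v0 v1 v2 b :
  znorm (octo a u0 u1 u2 v0 v1 v2 b) = a * b - (u0 * v0 + u1 * v1 + u2 * v2).
Proof. by rewrite /znorm dotE !row3E. Qed.

Lemma octo_trace a u0 u1 u2 v0 v1 v2 b :
  ztrace (octo a u0 u1 u2 v0 v1 v2 b) = a + b.
Proof. by []. Qed.

Definition octoE :=
  (octo1, octo_conj, octoD, octoZ, octoN, octoM, octo_q, octo_norm, octo_trace).

End Coordinates.

(** The algebra identities below are polynomial identities in the coordinates
    of their arguments, which [octoP] introduces. *)
Ltac octoring := rewrite ?octoE; congr octo; ring.

(** * Octonion identities *)

Section Octonions.
Variable F : fieldType.
Local Notation O := (zorn F).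
Local Notation "x ** y" := (zmul x y) (at level 40, left associativity).

Fact zconj_is_linear : linear (@zconj F).
Proof. by move=> c x y; elim/octoP: x => *; elim/octoP: y => *; octoring. Qed.
HB.instance Definition _ := GRing.isLinear.Build F O O _
  (@zconj F) zconj_is_linear.

Lemma zconjK : involutive (@zconj F).
Proof. by move=> x; elim/octoP: x => *; octoring. Qed.

Lemma zconjM (x y : O) : zconj (x ** y) = zconj y ** zconj x.
Proof. by elim/octoP: x => *; elim/octoP: y => *; octoring. Qed.

Lemma znorm_conj (x : O) : znorm (zconj x) = znorm x.
Proof. by elim/octoP: x => *; rewrite !octoE; ring. Qed.

Lemma zconj_trace (x : O) : zconj x = ztrace x *: zone F - x.
Proof. by elim/octoP: x => *; octoring. Qed.

Lemma zmulKV (x y : O) : x ** (zconj x ** y) = znorm x *: y.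
Proof. by elim/octoP: x => *; elim/octoP: y => *; octoring. Qed.

Lemma zmulrVK (x y : O) : (y ** zconj x) ** x = znorm x *: y.
Proof. by elim/octoP: x => *; elim/octoP: y => *; octoring. Qed.

(** The middle and left Moufang identities. They are what replaces
    associativity in the behaviour of [spin] under multiplications. *)
Lemma moufang_mid (x y z : O) : (x ** y) ** (z ** x) = (x ** (y ** z)) ** x.
Proof.
by elim/octoP: x => *; elim/octoP: y => *; elim/octoP: z => *; octoring.
Qed.

Lemma moufang_left (x y z : O) : ((x ** y) ** x) ** z = x ** (y ** (x ** z)).
Proof.
by elim/octoP: x => *; elim/octoP: y => *; elim/octoP: z => *; octoring.
Qed.

(** This is the polarised form of (z conj(y)) y = n(y) z. *)
Lemma zmul_conjl (y z w : O) :
  (z ** zconj y) ** w + (z ** zconj w) ** y = zq y w *: z.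
Proof.
by elim/octoP: y => *; elim/octoP: z => *; elim/octoP: w => *; octoring.
Qed.

(** Each vector e of the coordinate basis of O is paired with the vector dual to it
    for q. Signs occur because q pairs the two vector parts negatively. *)
Definition dual_pairs : seq (O * O) :=
  let p x y := [:: (x, y); (y, x)] in
  p (octo 1 0 0 0 0 0 0 0) (octo 0 0 0 0 0 0 0 1) ++
  p (octo 0 1 0 0 0 0 0 0) (octo 0 0 0 0 (-1) 0 0 0) ++
  p (octo 0 0 1 0 0 0 0 0) (octo 0 0 0 0 0 (-1) 0 0) ++
  p (octo 0 0 0 1 0 0 0 0) (octo 0 0 0 0 0 0 (-1) 0).

Let simpr := (@mul0r F, @mulr0 F, @add0r F, @addr0 F, @mul1r F, @mulr1 F,
  @oppr0 F, @subr0 F, @sub0r F, @mulN1r F, @mulrN1 F, @opprK F).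

Lemma parseval z : \sum_(e <- dual_pairs) zq z e.1 *: e.2 = z.
Proof.
rewrite /dual_pairs /= !big_cons big_nil addr0.
by elim/octoP: z => *; rewrite !octoE; congr octo; ring.
Qed.

Lemma parseval_swap z : \sum_(e <- dual_pairs) zq z e.2 *: e.1 = z.
Proof.
rewrite /dual_pairs /= !big_cons big_nil addr0.
by elim/octoP: z => *; rewrite !octoE; congr octo; ring.
Qed.

(** The trace of R_v* R_u, whose symmetry in u and v shows that [spin u v] is
    traceless. *)
Lemma trace_RR u v :
  \sum_(e <- dual_pairs) zq ((e.1 ** u) ** zconj v) e.2 = 4%:R * zq u v.
Proof.
rewrite /dual_pairs /= !big_cons big_nil addr0.
elim/octoP: u => *; rewrite ![octo _ _ _ _ _ _ _ _ ** _]octoM !simpr.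
by elim/octoP: v => *; rewrite !octoE; ring.
Qed.

(** This sum over the dual bases is the only non-formal ingredient of
    [triality_map_conj]. Antisymmetrised in u and v, it is a multiple of the
    rank 2 operator of the bivector u* ^ v*. *)
Lemma contraction u v z :
  \sum_(e <- dual_pairs) (z ** zconj e.2) ** ((e.1 ** u) ** zconj v) =
  2%:R *: (zq z (zconj u) *: zconj v - zq z (zconj v) *: zconj u + zq u v *: z).
Proof.
rewrite /dual_pairs /= !big_cons big_nil addr0.
(* The zeros of the basis vectors are simplified away as soon as they occur:
   without this the polynomials become too large. *)
elim/octoP: z => *; rewrite !octo_conj !octoM !simpr.
elim/octoP: u => *; rewrite !octoM !simpr.
elim/octoP: v => *; rewrite !octoE.
by congr octo; ring.
Qed.

(** The operator R_v* R_u - R_u* R_v, with stars for conjugates. This is, up to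
    a scalar, how the bivector u ^ v acts on one of the half-spin modules of
    SO(8), identified with O: triality on the Lie algebra of SO(8). *)
Definition spin u v z : O := (z ** u) ** zconj v - (z ** v) ** zconj u.

Lemma zmulrE (x y : O) : x ** y = zrmul y x. Proof. by []. Qed.

Fact spin_is_linear u v : linear (spin u v).
Proof.
move=> c x y; rewrite /spin !zmulrE !linearP /=.
by rewrite addrACA -scalerDr.
Qed.
HB.instance Definition _ u v := GRing.isLinear.Build F O O _
  (spin u v) (spin_is_linear u v).

Lemma spin_linearl v z : linear (fun u => spin u v z).
Proof.
move=> c x y; rewrite /spin linearP ![_ ** zconj v]zmulrE !linearP /=.
by rewrite addrACA -scalerDr.
Qed.

Lemma spinC u v z : spin u v z = - spin v u z.
Proof. by rewrite /spin opprB. Qed.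

(** By the Moufang identities R_(u x) L_x = L_x R_x R_u, and dually for the
    conjugate factor, so that the two occurrences of R_x cancel. *)
Lemma spinRL x u v z : znorm x = 1 ->
  spin (u ** x) (v ** x) (x ** z) = x ** spin u v z.
Proof.
move=> nx; have R a c : (x ** z ** (a ** x)) ** zconj (c ** x) =
    x ** ((z ** a) ** zconj c).
  by rewrite moufang_mid zconjM moufang_left zmulKV nx scale1r.
by rewrite /spin !R linearB.
Qed.

(** Conjugation of [spin u v] by P_x, freed of inverses: the inverse of P_x is
    z |-> (x z) x. *)
Lemma spinLP x u v z : znorm x = 1 ->
  (x ** spin (x ** u) (x ** v) z) ** x = spin u v ((x ** z) ** x).
Proof.
move=> nx; have R a c : (x ** ((z ** (x ** a)) ** zconj (x ** c))) ** x =
    ((x ** z) ** x ** a) ** zconj c.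
  by rewrite zconjM -moufang_mid zmulrVK nx scale1r moufang_left.
by rewrite /spin linearB /= [(_ - _) ** x]zmulrE linearB /= -!zmulrE !R.
Qed.

(** The operator form of T C T = 16 C, where T is [triality_map] and C is
    octonion conjugation. Polarisation reduces it to [contraction], up to the
    trace of [spin u v], which vanishes. *)
Lemma spin_conj_sum u v z :
  \sum_(e <- dual_pairs) spin (zconj e.2) (zconj (spin u v e.1)) z =
  8%:R *: (zq z (zconj u) *: zconj v - zq z (zconj v) *: zconj u).
Proof.
have E e : spin (zconj e.2) (zconj (spin u v e.1)) z =
    2%:R *: ((z ** zconj e.2) ** spin u v e.1) - zq (spin u v e.1) e.2 *: z.
  rewrite {1}/spin !zconjK -zmul_conjl scaler_nat mulr2n opprD.
  by rewrite addrACA subrr addr0.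
under eq_bigr do rewrite E.
rewrite sumrB -scaler_sumr -scaler_suml.
have -> : \sum_(e <- dual_pairs) zq (spin u v e.1) e.2 = 0.
  under eq_bigr => e _ do rewrite /spin zqC -[- _]scaleN1r addrC zqDZ mulN1r addrC.
  rewrite sumrB; under eq_bigr do rewrite zqC; rewrite trace_RR.
  by under eq_bigr do rewrite zqC; rewrite trace_RR [zq v u]zqC subrr.
rewrite scale0r subr0 /spin; under eq_bigr => e _ do rewrite linearB.
rewrite sumrB !contraction -scalerBr [zq v u]zqC opprD addrACA subrr addr0.
rewrite opprB -mulr2n -(scaler_nat 2) !scalerA.
by congr (_ *: _); ring.
Qed.

End Octonions.

(** * The linear triality map *)

Section TrialityMap.
Variable F : fieldType.
Local Notation O := (zorn F).
Local Notation dual := (dual_pairs F).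

(** The inverse, up to a factor 2, of the identification of bivectors with skew
    operators; see [bivector_rank2]. *)
Definition bivector (X : O -> O) : ext2 O :=
  \sum_(e <- dual) wedge e.2 (X e.1).

Lemma bivector_rank2 u v :
  bivector (fun z => zq z u *: v - zq z v *: u) = 2%:R *: wedge u v.
Proof.
have E x y : \sum_(e <- dual) wedge e.2 (zq e.1 x *: y) = wedge x y.
  rewrite -[in RHS](parseval x) -[wedge _ _]/(wedge_alt O _ _) alt_suml.
  by apply: eq_bigr => e _; rewrite linearZ /= zqC.
rewrite /bivector; under eq_bigr do rewrite linearB; rewrite sumrB !E.
by rewrite [wedge v u]wedgeC opprK -mulr2n scaler_nat.
Qed.

(** The tensor of the dual bases is invariant under isometries. Hence the
    bivector of the operator g X g^-1, here called Y, is the image under g of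
    that of X. *)
Lemma bivector_conj (g ginv X Y : {linear O -> O}) :
    (forall x y, zq (g x) (g y) = zq x y) -> cancel ginv g ->
    (forall z, Y (g z) = g (X z)) ->
  bivector Y = ext2_map (linfun g) (bivector X).
Proof.
move=> gq gK YX.
have E z : Y z = \sum_(f <- dual) zq z (g f.2) *: g (X f.1).
  rewrite -{1}[z]gK -(parseval_swap (ginv z)) !linear_sum.
  by apply: eq_bigr => f _; rewrite -YX !linearZ /= -[zq (ginv z) _]gq gK.
rewrite /bivector linear_sum; under eq_bigr do rewrite E linear_sum.
rewrite exchange_big; apply: eq_bigr => f _ /=.
rewrite ext2_map_wedge !lfunE -[in RHS](parseval (g f.2)).
rewrite -[wedge (\sum_(_ <- _) _) _]/(wedge_alt O _ _) alt_suml.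
by apply: eq_bigr => e _; rewrite linearZ /= zqC.
Qed.

Fact triality_map_linearl v : linear (fun u => bivector (spin u v)).
Proof.
move=> c x y; rewrite /bivector scaler_sumr -big_split; apply: eq_bigr => e _ /=.
by rewrite spin_linearl linearP.
Qed.
Fact triality_map_linearr u : linear (fun v => bivector (spin u v)).
Proof.
have N v : bivector (spin u v) = - bivector (spin v u).
  by rewrite /bivector -sumrN; apply: eq_bigr => e _; rewrite spinC linearN.
by move=> c x y; rewrite !N triality_map_linearl opprD scalerN.
Qed.
Fact triality_map_diag u : bivector (spin u u) = 0.
Proof.
by rewrite /bivector big1 // => e _; rewrite /spin subrr linear0.
Qed.

Definition triality_map : ext2 O -> ext2 O :=
  ext2_lift (Alternating triality_map_linearl triality_map_linearr triality_map_diag).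
HB.instance Definition _ := GRing.Linear.on triality_map.

Lemma triality_mapE u v : triality_map (wedge u v) = bivector (spin u v).
Proof. exact: ext2_liftE. Qed.

(** The hypothesis says that the operator of h u ^ h v is the conjugate by g of
    that of u ^ v. So h stands for the image of g under triality, up to sign. *)
Lemma triality_map_equiv (h : 'End(O)) (g : SO8 F) :
    (forall u v z, spin (h u) (h v) (g z) = g (spin u v z)) ->
  forall w, triality_map (ext2_map h w) = ext2_map g (triality_map w).
Proof.
move=> hg; apply: (eq_ext2 (f := triality_map \o ext2_map h)
  (g := ext2_map g \o triality_map)).
move=> u v; rewrite /= ext2_map_wedge !triality_mapE.
have gK : cancel (g^-1)%VF g.
  by move=> z; rewrite -comp_lfunE lker0_compfV ?SO8_ker ?id_lfunE.
rewrite (@bivector_conj g (g^-1)%VF (spin u v) _ _ gK (hg u v)); last first.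
  by move=> x y; apply: SO8P.
by congr (ext2_map _ _); apply/lfunP => z; rewrite lfunE.
Qed.

Definition Conj : 'End(O) := linfun (@zconj F).

Lemma ConjK x : ext2_map Conj (ext2_map Conj x) = x.
Proof.
rewrite -ext2_map_comp -[RHS]ext2_map1; congr (ext2_map _ x).
by apply/lfunP => z; rewrite comp_lfunE !lfunE /= zconjK.
Qed.

Lemma triality_map_conj x :
  triality_map (ext2_map Conj (triality_map x)) = 16%:R *: ext2_map Conj x.
Proof.
pose f : {linear ext2 O -> ext2 O} := 16%:R \*: ext2_map Conj.
apply: (eq_ext2 (f := triality_map \o ext2_map Conj \o triality_map)
  (g := f)) x => u v.
rewrite /= triality_mapE /bivector !linear_sum /=.
under eq_bigr do rewrite ext2_map_wedge triality_mapE.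
transitivity (bivector (fun z =>
    8%:R *: (zq z (zconj u) *: zconj v - zq z (zconj v) *: zconj u))).
  rewrite /bivector exchange_big; apply: eq_bigr => k _ /=.
  rewrite -linear_sum -spin_conj_sum; congr (wedge _ _).
  by apply: eq_bigr => e _; rewrite !lfunE.
rewrite /bivector; under eq_bigr do rewrite linearZ.
rewrite -scaler_sumr [X in _ *: X]bivector_rank2 scalerA ext2_map_wedge !lfunE.
by congr (_ *: _); ring.
Qed.

(** From T C T = 16 C and C C = 1, the inverse of T is C T C / 16. *)
Lemma triality_map_bij : 2%:R != 0 :> F -> bijective triality_map.
Proof.
move=> F2; have n16 : 16%:R != 0 :> F by rewrite (natrX F 2 4) expf_neq0.
exists (fun y => 16%:R^-1 *: ext2_map Conj (triality_map (ext2_map Conj y))) => x.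
  by rewrite triality_map_conj linearZ /= ConjK scalerA mulVf ?scale1r.
by rewrite linearZ /= triality_map_conj ConjK scalerA mulVf ?scale1r.
Qed.

End TrialityMap.

(** * Splitting the exterior square over SO(7) *)

Section Splitting.
Variable F : fieldType.
Hypothesis F2 : 2%:R != 0 :> F.
Local Notation O := (zorn F).
Local Notation U := (subvs_of (O0 F)).

(** The orthogonal projection onto O_0. Composing with [vsproj] is only a change
    of type, since its argument is traceless; alone, [vsproj] would project
    along an arbitrary complement. *)
Definition traceless (z : O) : U :=
  vsproj (O0 F) (z - (ztrace z / 2%:R) *: zone F).

Fact traceless_is_linear : linear traceless.
Proof.
move=> c x y; rewrite /traceless -linearP; congr (vsproj _ _).
rewrite linearP /= mulrDl scalerDl scalerBr opprD addrACA scalerA.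
by rewrite mulrA.
Qed.
HB.instance Definition _ := GRing.isLinear.Build F O U _
  traceless traceless_is_linear.

Lemma ztrace1 : ztrace (zone F) = 2%:R.
Proof. by rewrite octo1 octo_trace. Qed.

Lemma vsval_traceless z :
  vsval (traceless z) = z - (ztrace z / 2%:R) *: zone F.
Proof.
rewrite vsprojK // mem_O0 linearB linearZ /= ztrace1.
by rewrite -[_ *: _]/(_ * _) divfK ?subrr.
Qed.

Lemma ztrace_vsval (a : U) : ztrace (vsval a) = 0.
Proof. by apply/eqP; rewrite -mem_O0 subvsP. Qed.

Lemma traceless_vsval (a : U) : traceless (vsval a) = a.
Proof.
by apply: subvs_inj; rewrite vsval_traceless ztrace_vsval mul0r scale0r subr0.
Qed.

Lemma traceless1 : traceless (zone F) = 0.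
Proof.
by apply: subvs_inj; rewrite vsval_traceless ztrace1 divff // scale1r subrr linear0.
Qed.

(** This is the value at 1 of the skew operator of u ^ v, which is t(u) v - t(v) u;
    the projections only record that this difference is traceless. *)
Definition contr (u v : O) : U :=
  (ztrace u : F) *: traceless v - (ztrace v : F) *: traceless u.

Fact contr_linearl v : linear (contr^~ v).
Proof.
move=> c x y.
have tP : ztrace (c *: x + y) = c * ztrace x + ztrace y :> F by exact: linearP.
rewrite /contr tP linearP /=; move: (ztrace x : F) (ztrace y : F) (ztrace v : F).
move: (traceless x) (traceless y) (traceless v) => x' y' v' s t r.
by rewrite scalerDl !scalerDr opprD addrACA scalerN !scalerA [r * c]mulrC.
Qed.
Fact contr_linearr u : linear (contr u).
Proof.
have N v : contr u v = - contr v u by rewrite /contr opprB.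
by move=> c x y; rewrite !N contr_linearl opprD scalerN.
Qed.
Fact contr_diag u : contr u u = 0. Proof. exact: subrr. Qed.

Definition ext2_contr : ext2 O -> U :=
  ext2_lift (Alternating contr_linearl contr_linearr contr_diag).
HB.instance Definition _ := GRing.Linear.on ext2_contr.

Lemma ext2_contrE u v : ext2_contr (wedge u v) = contr u v.
Proof. exact: ext2_liftE. Qed.

Definition split2 (x : ext2 O) : (U * ext2 U)%type :=
  (ext2_contr x, ext2_functor traceless x).

Fact split2_is_linear : linear split2.
Proof. by move=> c x y; rewrite /split2 !linearP. Qed.
HB.instance Definition _ := GRing.isLinear.Build F (ext2 O) (U * ext2 U)%type _
  split2 split2_is_linear.

Definition unsplit2 (p : U * ext2 U) : ext2 O :=
  2%:R^-1 *: wedge (zone F) (vsval p.1) + ext2_functor vsval p.2.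

Lemma split2K : cancel split2 unsplit2.
Proof.
pose f : {linear ext2 O -> ext2 O} :=
  (2%:R^-1 \*: (wedge (zone F) \o vsval \o ext2_contr)) \+
  (ext2_functor vsval \o ext2_functor traceless).
apply: (eq_ext2 (f := f) (g := idfun)) => u v.
rewrite /= !ext2_functorE ext2_contrE /contr linearB !linearZ /= !vsval_traceless.
rewrite !(wedgeBr, wedgeBl) wedgexx [wedge u (zone F)]wedgeC.
rewrite !scaler0 !subr0 !scalerN opprK scalerBr !scalerA ![2%:R^-1 * _]mulrC.
set X := _ *: wedge _ v; set Y := _ *: wedge _ u.
by rewrite -[_ - X + Y]addrA [- X + Y]addrC -[Y - X]opprB [LHS]addrC subrK.
Qed.

Lemma unsplit2K : cancel unsplit2 split2.
Proof.
case=> a y; rewrite /unsplit2 /= linearD linearZ /=.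
have -> : split2 (wedge (zone F) (vsval a)) = (2%:R *: a, 0).
  rewrite /split2 ext2_contrE ext2_functorE /= traceless1 wedge0l /contr.
  by rewrite traceless1 ztrace1 traceless_vsval scaler0 subr0.
have -> : split2 (ext2_functor vsval y) = (0, y).
  congr (_, _).
    apply: (eq_ext2 (f := ext2_contr \o ext2_functor vsval) (g := \0)) y => u v.
    rewrite /= ext2_functorE ext2_contrE /contr /= !ztrace_vsval.
    by rewrite !scale0r subrr.
  apply: (eq_ext2 (f := ext2_functor traceless \o ext2_functor vsval)
    (g := idfun)) y => u v.
  by rewrite /= !ext2_functorE /= !traceless_vsval.
by congr (_, _); rewrite /= ?scaler0 ?addr0 ?add0r ?scalerA ?mulVf ?scale1r.
Qed.

Lemma split2_equiv (g : SO8 F) x : g \in @SO7 F ->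
  split2 (ext2_map g x) = (resO0 g (split2 x).1, ext2_map (resO0 g) (split2 x).2).
Proof.
move=> g7; have tg z : ztrace (g z) = ztrace z.
  by rewrite -!zq1 -{1}(eqP g7) SO8P.
have pg z : traceless (g z) = resO0 g (traceless z).
  apply: subvs_inj; rewrite resO0E // !vsval_traceless.
  rewrite [in RHS]linearB [in RHS]linearZ /=.
  by rewrite (eqP g7) tg.
congr (_, _).
  apply: (eq_ext2 (f := ext2_contr \o ext2_map g) (g := resO0 g \o ext2_contr)) x.
  move=> u v; rewrite /= ext2_map_wedge !ext2_contrE /contr linearB !linearZ /=.
  by rewrite !tg !pg.
apply: (eq_ext2 (f := ext2_functor traceless \o ext2_map g)
  (g := ext2_map (resO0 g) \o ext2_functor traceless)) x => u v.
by rewrite /= ext2_map_wedge !ext2_functorE ext2_map_wedge /= !pg.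
Qed.

End Splitting.

(** * Multiplications generate SO(8) *)

Section Determinant.

(** The block matrix with diagonal blocks 1 and off-diagonal blocks r and c is
    in two ways a product of block triangular matrices, one for each side. *)
Lemma det_sub_rank1 (R : comNzRingType) n (c : 'cV[R]_n) (r : 'rV[R]_n) :
  \det (1%:M - c *m r) = 1 - (r *m c) 0 0.
Proof.
have E1 : block_mx 1%:M r c 1%:M =
    block_mx 1%:M 0 c 1%:M *m block_mx 1%:M r 0 (1%:M - c *m r).
  by rewrite mulmx_block !(mul1mx, mulmx1, mul0mx, addr0) addrC subrK.
have E2 : block_mx 1%:M r c 1%:M =
    block_mx (1%:M - r *m c) r 0 1%:M *m block_mx 1%:M 0 c 1%:M.
  by rewrite mulmx_block !(mul1mx, mulmx1, mulmx0, add0r) subrK.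
have := congr1 determinant E1.
rewrite E2 !det_mulmx !det_lblock !det_ublock !det1 !mul1r !mulr1 => <-.
by rewrite det_mx11 !mxE eqxx.
Qed.

Lemma lfun_det_sub_rank1 (F : fieldType) (V : vectType F)
    (phi : {linear V -> F^o}) (w : V) (f : 'End(V)) :
  (forall z, f z = z - (phi z : F) *: w) -> lfun_det f = 1 - phi w.
Proof.
move=> fE; pose b := vbasis {:V}; have bB : basis_of {:V} b := vbasisP _.
pose c : 'cV[F]_(\dim {:V}) := \col_i phi b`_i.
have cE z : phi z = (rVof b z *m c) 0 0.
  rewrite {1}(coord_vbasis (memvf z)) linear_sum mxE; apply: eq_bigr => i _.
  by rewrite linearZ /= !mxE.
rewrite /lfun_det cE -det_sub_rank1; congr (\det _); apply/row_matrixP => i.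
rewrite rowE mul_mxof fE linearB linearZ /= vecofK // [row i _]linearB /=.
rewrite row1 row_mul; congr (_ - _).
have -> : row i c = (phi (vecof b (delta_mx 0 i)))%:M.
  by apply/rowP=> j; rewrite !ord1 vecof_delta !mxE eqxx.
by rewrite mul_scalar_mx.
Qed.

(** Conjugation is t(z) 1 - z, the opposite of a rank 1 perturbation of the
    identity, and dim O is even. *)
Lemma det_Conj (F : fieldType) : lfun_det (Conj F) = -1.
Proof.
rewrite -[Conj F]opprK lfun_detN dim_zorn -signr_odd expr0 mul1r.
rewrite (@lfun_det_sub_rank1 _ _ (@ztrace F) (zone F)) => [|z].
  by rewrite /= ztrace1 opprD addrA subrr add0r.
by rewrite opp_lfunE lfunE /= zconj_trace opprB.
Qed.

End Determinant.

Section Reflections.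
Variable F : fieldType.
Local Notation O := (zorn F).
Local Notation "x ** y" := (zmul x y) (at level 40, left associativity).

Definition refl (a z : O) : O := z - zq z a *: a.

Fact refl_is_linear a : linear (refl a).
Proof.
move=> c x y; rewrite /refl zqC zqDZ ![zq a _]zqC scalerDl scalerBr scalerA.
by rewrite opprD addrACA.
Qed.
HB.instance Definition _ a := GRing.isLinear.Build F O O _
  (refl a) (refl_is_linear a).

Lemma zqDl (x y z : O) : zq (x + y) z = zq x z + zq y z.
Proof. by rewrite !zq_ZE !dotE !zE !rV3E; ring. Qed.
Lemma zqNl (x y : O) : zq (- x) y = - zq x y.
Proof.
by have := zqDZ y x 0 (-1);
  rewrite addr0 zq0 addr0 scaleN1r mulN1r ![zq y _]zqC.
Qed.
Lemma zqZl c (x y : O) : zq (c *: x) y = c * zq x y.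
Proof. by have := zqDZ y x 0 c; rewrite addr0 zq0 addr0 ![zq y _]zqC. Qed.
Lemma zqDr (x y z : O) : zq z (x + y) = zq z x + zq z y.
Proof. by rewrite zqC zqDl ![zq _ z]zqC. Qed.
Lemma zqNr (x y : O) : zq y (- x) = - zq y x.
Proof. by rewrite zqC zqNl zqC. Qed.
Lemma zqZr c (x y : O) : zq y (c *: x) = c * zq y x.
Proof. by rewrite zqC zqZl zqC. Qed.
Definition zqE := (zqDl, zqNl, zqZl, zqDr, zqNr, zqZr).
Lemma zqxx (x : O) : zq x x = 2%:R * znorm x.
Proof. by elim/octoP: x => *; rewrite !octoE; ring. Qed.

Lemma zq_refl a x y : znorm a = 1 -> zq (refl a x) (refl a y) = zq x y.
Proof.
by move=> na; rewrite /refl !zqE zqxx na [zq a y]zqC; ring.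
Qed.

Lemma reflK a : znorm a = 1 -> involutive (refl a).
Proof.
move=> na x; rewrite {1}/refl /refl !zqE zqxx na.
rewrite -addrA -opprD -scalerDl -[RHS]subr0; congr (_ - _).
by rewrite -[RHS](scale0r a); congr (_ *: _); ring.
Qed.

(** With conjugation, a reflection becomes a product of multiplications: the
    reflection in a sends z to - a z* a. The two versions move the conjugation
    to the left of the multiplications, or cancel it. *)
Lemma refl_conj a z : znorm a = 1 ->
  refl a z = zconj ((- zconj a) ** (z ** zconj a)).
Proof.
move=> na; rewrite /refl -[X in X - _]scale1r -na.
by elim/octoP: a {na} => *; elim/octoP: z => *; octoring.
Qed.

Lemma refl_zconj a z : znorm a = 1 -> refl a (zconj z) = (- a) ** (z ** a).
Proof.
move=> na; rewrite /refl -[X in X - _]scale1r -na.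
by elim/octoP: a {na} => *; elim/octoP: z => *; octoring.
Qed.

Lemma znormN (x : O) : znorm (- x) = znorm x.
Proof. by elim/octoP: x => *; rewrite !octoE; ring. Qed.

(** An orthogonal basis without isotropic vectors: the sums and differences of
    the coordinate vectors that q pairs. *)
Definition orth_frame : seq O :=
  [:: octo 1 0 0 0 0 0 0 1;    octo 1 0 0 0 0 0 0 (-1);
      octo 0 1 0 0 1 0 0 0;    octo 0 1 0 0 (-1) 0 0 0;
      octo 0 0 1 0 0 1 0 0;    octo 0 0 1 0 0 (-1) 0 0;
      octo 0 0 0 1 0 0 1 0;    octo 0 0 0 1 0 0 (-1) 0].

Lemma orth_frame_expand z :
  \sum_(b <- orth_frame) (znorm b * zq z b) *: b = 2%:R *: z.
Proof.
rewrite /orth_frame !big_cons big_nil addr0.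
by elim/octoP: z => *; octoring.
Qed.

Lemma orth_frame_orth : pairwise (fun b c => zq b c == 0) orth_frame.
Proof.
rewrite /= !octo_q ?andbT.
by do ?[apply/andP; split]; apply/eqP; ring.
Qed.

Lemma orth_frame_norm : all (fun b => znorm b != 0) orth_frame.
Proof.
rewrite /= !octo_norm !(mulr0, mul0r, mulr1, mul1r, addr0, add0r, subr0, sub0r).
by rewrite opprK !oppr_eq0 oner_neq0.
Qed.

End Reflections.

Section Generation.
Variable F : closedFieldType.
Hypothesis F2 : 2%:R != 0 :> F.
Local Notation O := (zorn F).
Local Notation "x ** y" := (zmul x y) (at level 40, left associativity).

Let F_char : 2%N \notin [pchar F].
Proof. by rewrite inE /=. Qed.

(** Over an algebraically closed field every anisotropic direction contains a
    vector of norm 1. *)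
Lemma refl_dir (w : O) : znorm w != 0 ->
  exists2 a, znorm a = 1 & forall z, refl a z = z - (zq z w / znorm w) *: w.
Proof.
move=> nw; have [s s2] : exists s : F, s ^+ 2 = znorm w.
  have [s] := @solve_monicpoly F 2
    (fun i => if i == 0%N then znorm w else 0) isT.
  rewrite !big_ord_recl big_ord0 /= expr0 mulr1 mul0r !addr0 => s2.
  by exists s.
exists (s^-1 *: w); first by rewrite znormZ exprVn s2 mulVf.
move=> z; rewrite /refl zqE scalerA; congr (_ - _ *: _).
by rewrite mulrAC -expr2 exprVn s2 mulrC.
Qed.

Variable P : SO8 F -> Prop.
Hypothesis PM : forall g h, P g -> P h -> P (g * h)%g.
Hypothesis PL : forall x, znorm x = 1 -> P (SO8_L x).
Hypothesis PR : forall x, znorm x = 1 -> P (SO8_R x).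

(** The isometries accounted for by a predicate P on SO(8), up to conjugation.
    Conjugation stands on the left, where it meets the next reflection. *)
Definition proper_or_conj (f : O -> O) :=
  exists2 h : SO8 F, P h & f =1 h \/ f =1 (@zconj F) \o h.

Lemma proper_or_conj_refl a f : znorm a = 1 ->
  proper_or_conj f -> proper_or_conj (refl a \o f).
Proof.
move=> na [h Ph fh].
have Pmul x : znorm x = 1 -> P (SO8_L (- x) * (SO8_R x * h))%g.
  by move=> nx; apply: PM; [apply: PL|apply: PM => //; apply: PR]; rewrite ?znormN.
have mulE x z : znorm x = 1 ->
    (SO8_L (- x) * (SO8_R x * h))%g z = (- x) ** (h z ** x).
  move=> nx; have nNx : znorm (- x) = 1 by rewrite znormN.
  by rewrite /= !comp_lfunE val_SO8_L // val_SO8_R // LmulE RmulE.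
have nca : znorm (zconj a) = 1 by rewrite znorm_conj.
case: fh => fh.
  exists (SO8_L (- zconj a) * (SO8_R (zconj a) * h))%g; first exact: Pmul.
  by right=> z; rewrite /= fh refl_conj // -mulE.
exists (SO8_L (- a) * (SO8_R a * h))%g; first exact: Pmul.
by left=> z; rewrite mulE //= fh refl_zconj.
Qed.

Lemma proper_or_conj_reflV a f : znorm a = 1 ->
  proper_or_conj (refl a \o f) -> proper_or_conj f.
Proof.
move=> na /(proper_or_conj_refl na)[h Ph fh]; exists h => //.
by case: fh => fh; [left|right] => z; rewrite -fh /= reflK.
Qed.

Definition isometry (f : O -> O) := forall x y, zq (f x) (f y) = zq x y.

(** If x - b is anisotropic the reflection in it exchanges x and b. Otherwise
    x + b is anisotropic, because n(x - b) + n(x + b) = 4 n(b), and its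
    reflection sends x to - b, which the reflection in b sends to b. Vectors
    orthogonal to x and b are fixed in both cases. *)
Lemma move_to (x b : O) (l : seq O) : znorm x = znorm b -> znorm b != 0 ->
    {in l, forall c, zq x c = 0} -> {in l, forall c, zq b c = 0} ->
  exists r : {linear O -> O}, [/\ isometry r, r x = b, {in l, forall c, r c = c} &
    forall f, proper_or_conj (r \o f) -> proper_or_conj f].
Proof.
move=> nx nb xl bl.
have refl_fix (w a c : O) : (forall z, refl a z = z - (zq z w / znorm w) *: w) ->
    zq w c = 0 -> refl a c = c.
  by move=> -> wc; rewrite zqC wc mul0r scale0r subr0.
have nB : znorm (x - b) = 2%:R * znorm b - zq x b.
  have := zqxx (x - b); rewrite !zqE !zqxx nx [zq b x]zqC => e.
  by apply: (mulfI F2); rewrite -e; ring.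
have nD : znorm (x + b) = 2%:R * znorm b + zq x b.
  have := zqxx (x + b); rewrite !zqE !zqxx nx [zq b x]zqC => e.
  by apply: (mulfI F2); rewrite -e; ring.
have [w0|w0] := eqVneq (znorm (x - b)) 0; last first.
  have [a na ra] := refl_dir w0; exists (refl a); split=> //.
  - by move=> y z; apply: zq_refl.
  - by rewrite /= ra !zqE zqxx nx -nB divff // scale1r opprB addrC subrK.
  - by move=> c lc; apply: (refl_fix _ _ _ ra); rewrite !zqE xl // bl // subr0.
  - by move=> f; apply: proper_or_conj_reflV.
have wD : znorm (x + b) != 0.
  suff -> : znorm (x + b) = 2%:R * (2%:R * znorm b) by rewrite !mulf_neq0.
  have -> : znorm (x + b) = 2%:R * (2%:R * znorm b) - znorm (x - b).
    by rewrite nB nD; ring.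
  by rewrite w0 subr0.
have [a na ra] := refl_dir wD; have [a' na' ra'] := refl_dir nb.
exists (refl a' \o refl a); split.
- by move=> y z; rewrite /= !zq_refl.
- rewrite /= ra !zqE zqxx nx -nD divff // scale1r opprD addrA subrr add0r.
  rewrite ra' zqE zqxx mulNr mulfK // scaleNr opprK.
  by rewrite -{1}[b]scale1r -scaleNr -scalerDl -[RHS]scale1r; congr (_ *: _); ring.
- move=> c lc /=; rewrite (refl_fix _ _ _ ra) ?(refl_fix _ _ _ ra') ?bl //.
  by rewrite !zqE xl // bl // addr0.
- by move=> f H; apply: (proper_or_conj_reflV na); apply: (proper_or_conj_reflV na').
Qed.

(** Cartan-Dieudonne: vectors of an orthogonal list are fixed one at a time, from
    the last to the first; [move_to] does not disturb those already fixed. *)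
Lemma fix_frame (l : seq O) (f : {linear O -> O}) :
    pairwise (fun b c => zq b c == 0) l -> all (fun b => znorm b != 0) l ->
    isometry f ->
  exists f' : {linear O -> O}, [/\ isometry f', {in l, forall c, f' c = c} &
    proper_or_conj f' -> proper_or_conj f].
Proof.
move=> + + fq; elim: l => [|b l IHl] /=; first by exists f.
case/andP => /allP bl /IHl{}IHl /andP[nb /IHl[f1 [f1q f1l f1f]]].
have bl0 : {in l, forall c, zq b c = 0} by move=> c /bl/eqP.
have nx : znorm (f1 b) = znorm b.
  by apply: (mulfI F2); rewrite -!zqxx f1q.
have [|r [rq rx rl rf]] := move_to nx nb _ bl0.
  by move=> c lc; rewrite -[c in LHS]f1l // f1q bl0.
exists (r \o f1); split.
- by move=> y z; rewrite /= rq f1q.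
- move=> c; rewrite inE => /orP[/eqP ->//|lc].
  by rewrite /= f1l // rl.
- by move=> H; apply/f1f/rf.
Qed.

(** The reflections express g up to a conjugation on the left, which is excluded
    by its determinant. *)
Lemma SO8_ind_LR g : P g.
Proof.
have [f [_ fl]] := fix_frame (orth_frame_orth F) (orth_frame_norm F) (@SO8P F g).
have fid z : f z = z.
  apply: (scalerI F2); rewrite -linearZ -orth_frame_expand linear_sum.
  rewrite [RHS]big_seq [LHS]big_seq; apply: eq_bigr => b bl.
  by rewrite linearZZ fl.
have n1 : znorm (zone F) = 1 by rewrite octo1 octo_norm; ring.
case.
  exists (SO8_L (zone F)); first exact: PL.
  left=> z; rewrite fid (val_SO8_L F_char n1) LmulE octo1.
  by elim/octoP: z => *; rewrite octoM; congr octo; ring.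
move=> h Ph [gh|gh].
  by have -> : g = h by apply/val_inj/lfunP.
have gC : so8_val g = (Conj F \o h)%VF.
  by apply/lfunP => z; rewrite comp_lfunE lfunE gh.
have := SO8_det g; rewrite gC lfun_detM det_Conj SO8_det mulr1 => /eqP.
by rewrite eq_sym -addr_eq0 => e; case/negP: F2.
Qed.

End Generation.

(** * The twisted module *)

Theorem proposition6p6 (F : closedFieldType) (F_char : 2%N \notin [pchar F])
    (rho : PSO8 F -> PSO8 F) (rho_triality : triality rho) :
  exists phi : {linear ext2 (zorn F) ->
                  (subvs_of (O0 F) * ext2 (subvs_of (O0 F)))%type},
    bijective phi /\
    (forall (g : SO8 F) (v : ext2 (zorn F)), g \in @SO7 F ->
       phi (PSO8_act (rho (\pi_(PSO8 F) g)) v) =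
         (resO0 g (phi v).1, ext2_map (resO0 g) (phi v).2)).
Proof.
have F2 : 2%:R != 0 :> F by move: F_char; rewrite inE.
have [_ rhoM _ rhoLR] := rho_triality.
pose intertwines (h : SO8 F) (g : SO8 F) :=
  forall w, triality_map (ext2_map h w) = ext2_map g (triality_map w).
have RL x : znorm x = 1 -> intertwines (SO8_R x) (SO8_L x).
  move=> nx; apply: triality_map_equiv => u v z.
  by rewrite (val_SO8_R F_char) // (val_SO8_L F_char) // !RmulE !LmulE spinRL.
(* The element (R_x L_x)^-1 is P_x. *)
have LP x : znorm x = 1 -> intertwines (SO8_L x) (SO8_R x * SO8_L x)^-1%g.
  move=> nx; apply: triality_map_equiv => u v z; set g := (_ * _)%g.
  have gE y : g y = zmul (zmul x y) x.
    rewrite /= comp_lfunE (val_SO8_R F_char) // (val_SO8_L F_char) //.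
    by rewrite RmulE LmulE.
  have gK : cancel g (g^-1)%g.
    by move=> y; rewrite -comp_lfunE lker0_compVf ?SO8_ker ?id_lfunE.
  have gKV : cancel (g^-1)%g g.
    by move=> y; rewrite -comp_lfunE lker0_compfV ?SO8_ker ?id_lfunE.
  apply: (can_inj gK); rewrite gKV gE (val_SO8_L F_char) // !LmulE.
  by rewrite spinLP // -gE gKV.
have iM h g h' g' : intertwines h g -> intertwines h' g' ->
    intertwines (h * h')%g (g * g')%g.
  by move=> hg hg' w; rewrite !ext2_map_comp hg hg'.
have iV h g : intertwines h g -> intertwines (h^-1)%g (g^-1)%g.
  move=> hg w.
  have VK (k : SO8 F) x : ext2_map (k^-1)%g (ext2_map k x) = x.
    by rewrite -ext2_map_comp lker0_compVf ?SO8_ker ?ext2_map1.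
  have KV (k : SO8 F) x : ext2_map k (ext2_map (k^-1)%g x) = x.
    by rewrite -ext2_map_comp lker0_compfV ?SO8_ker ?ext2_map1.
  by rewrite -[LHS](VK g) -hg KV.
have piM (g h : SO8 F) : \pi_(PSO8 F) (g * h)%g =
    (\pi_(PSO8 F) g * \pi_(PSO8 F) h)%g :> PSO8 F by exact: pi_PSO8M.
have piV (g : SO8 F) : \pi_(PSO8 F) g^-1%g = (\pi_(PSO8 F) g)^-1%g :> PSO8 F.
  exact: pi_PSO8V.
have rho_intertwines g w :
    triality_map (PSO8_act (rho (\pi_(PSO8 F) g)) w) = ext2_map g (triality_map w).
  (* Triality is only known at the multiplications, where its value has an
     explicit representative h; the representative is carried along. *)
  pose P g := exists2 h, rho (\pi_(PSO8 F) g) = \pi_(PSO8 F) h & intertwines h g.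
  suff [h -> hg] : P g by rewrite PSO8_act_pi.
  apply: (SO8_ind_LR F2) => [g1 g2 [h1 e1 i1] [h2 e2 i2]|x nx|x nx].
  - exists (h1 * h2)%g; last exact: iM.
    by rewrite piM rhoM e1 e2 -piM.
  - by exists (SO8_R x); [have [_ ->] := rhoLR x nx | apply: RL].
  exists ((SO8_L x)^-1 * (SO8_R x)^-1)%g.
    have [-> _ _] := rhoLR x nx.
    by rewrite /PSO8_P piM !piV.
  (* Triality sends R_x to P_x = L_x^-1 R_x^-1, which is intertwined with
     (P_x)^-1 L_x^-1 = R_x. *)
  have := iM _ _ _ _ (iV _ _ (LP x nx)) (iV _ _ (RL x nx)).
  by rewrite invgK mulgK.
exists (split2 (F:=F) \o @triality_map F); split.
  apply: bij_comp (triality_map_bij F2).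
  by exists (@unsplit2 F); [apply: split2K|apply: unsplit2K].
by move=> g v g7; rewrite /= rho_intertwines split2_equiv.
Qed.
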